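(* Every semi-algebraic set $\Theta\subseteq\mathbb{R}^k$ is everywhere Chernoff-regular; that is, $\Theta$ is Chernoff-regular at every point $\theta\in\Theta$.
   Context: Basic semi-algebraic set: a subset of $\mathbb{R}^k$ of the form $\{\theta\in\mathbb{R}^k \mid f(\theta)=0\ \forall f\in F,\ h(\theta)>0\ \forall h\in H\}$, where $F,H\subset\mathbb{R}[t_1,\dots,t_k]$ are (possibly empty) collections of polynomials and $H$ is finite. A semi-algebraic set is a finite union of basic semi-algebraic sets. Tangent cone: for $\Theta\subseteq\mathbb{R}^k$ and $\theta\in\mathbb{R}^k$, $T_\Theta(\theta)$ is the set of vectors in $\mathbb{R}^k$ that are limits of sequences $\alpha_n(\theta_n-\theta)$, where $\alpha_n$ are positive reals and $\theta_n\in\Theta$ converge to $\theta$. Chernoff-regularity: $\Theta\subseteq\mathbb{R}^k$ is Chernoff-regular at $\theta$ if for every $\tau\in T_\Theta(\theta)$ there exist $\varepsilon>0$ and a map $\alpha:[0,\varepsilon)\to\Theta$ with $\alpha(0)=\theta$ such that $\tau=\lim_{t\to0+}[\alpha(t)-\alpha(0)]/t$. *)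

(* Defs.v *)
From mathcomp Require Import all_boot all_order all_algebra.
From mathcomp Require Import all_classical all_reals all_analysis.
(* mpoly is not imported: its notations clash with those of mathcomp-analysis *)
From mathcomp Require mpoly.

Set Implicit Arguments.
Unset Strict Implicit.
Unset Printing Implicit Defensive.

Import Order.TTheory GRing.Theory Num.Theory.
Import numFieldNormedType.Exports.

Local Open Scope classical_set_scope.
Local Open Scope ring_scope.

Definition mpeval (R : realType) (k : nat) (f : mpoly.mpoly k R)
    (theta : 'rV[R]_k) : R :=
  mpoly.meval (fun i => theta ord0 i) f.

(* F may be infinite *)
Definition basic_semialgebraic (R : realType) (k : nat)
    (B : set 'rV[R]_k) : Prop :=
  exists F H : set (mpoly.mpoly k R),
    finite_set H /\
    B = [set theta | (forall f, F f -> mpeval f theta = 0) /\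
                     (forall h, H h -> 0 < mpeval h theta)].

Definition semialgebraic (R : realType) (k : nat)
    (Theta : set 'rV[R]_k) : Prop :=
  exists (m : nat) (B : 'I_m -> set 'rV[R]_k),
    (forall i, basic_semialgebraic (B i)) /\
    Theta = \bigcup_(i in [set: 'I_m]) B i.

Definition tangent_cone (R : realType) (k : nat)
    (Theta : set 'rV[R]_k) (theta : 'rV[R]_k) : set 'rV[R]_k :=
  [set tau | exists (a : nat -> R) (u : nat -> 'rV[R]_k),
    [/\ forall n, 0 < a n,
        forall n, Theta (u n),
        u n @[n --> \oo] --> theta &
        a n *: (u n - theta) @[n --> \oo] --> tau]].

(* alpha is a total function of which only the restriction to [0, eps)
   is constrained *)
Definition Chernoff_regular (R : realType) (k : nat)
    (Theta : set 'rV[R]_k) (theta : 'rV[R]_k) : Prop :=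
  forall tau, tangent_cone Theta theta tau ->
  exists (eps : R) (alpha : R -> 'rV[R]_k),
    [/\ 0 < eps,
        forall t : R, 0 <= t < eps -> Theta (alpha t),
        alpha 0 = theta &
        t^-1 *: (alpha t - alpha 0) @[t --> 0^'+] --> tau].

(* Main.v *)
(** Fix a tangent direction tau at theta. For e > 0 the set of all t > 0 for which
    Theta has a point within e t of theta + t tau is, by quantifier elimination, given
    by sign conditions on finitely many polynomials in t, so it either contains or
    misses some interval (0, d). A sequence a_n (u_n - theta) --> tau with tau <> 0
    forces 1 / a_n --> 0, and the points u_n show that the t = 1 / a_n are eventually in
    this set: it contains an interval (0, d). Hence the distance from theta + t tau to
    Theta is o(t), and as Chernoff regularity does not ask for a continuous curve,
    alpha t can be any point of Theta that realizes this distance up to t^2.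
    Infinitely many equations are reduced to finitely many by Dickson's lemma applied
    to the leading monomials of the vanishing ideal. *)
Require Import Defs.
From mathcomp Require Import all_boot all_order all_algebra.
From mathcomp Require Import all_classical all_reals all_analysis.
From mathcomp Require Import -(notations) mpoly.
From mathcomp Require Import lra.
From mathcomp Require polyrcf ordered_qelim qe_rcf.
Module ord := ordered_qelim.ord.
Import Order.TTheory GRing.Theory Num.Theory.
Import numFieldNormedType.Exports.

Local Open Scope classical_set_scope.
Local Open Scope ring_scope.

(** * Dickson's lemma and the reduction to finitely many equations *)

(** Induction on the number of coordinates. The set [s0] found for all but the last coordinate can
    fail only on elements whose last coordinate is below [M], and each of these finitely many slices
    has a finite set of its own. *)
Lemma dickson (n : nat) {A : eqType} (S : set A) (g : A -> nat -> nat) :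
  exists2 s : seq A, (forall b, b \in s -> S b) &
    forall a, S a -> exists2 b, b \in s & forall i, (i < n)%N -> (g b i <= g a i)%N.
Proof.
elim: n S => [|n IHn] S.
  have [[a Sa]|S0] := pselect (exists a, S a).
    by exists [:: a] => [b|b _]; [rewrite inE => /eqP -> | exists a; rewrite ?inE].
  by exists [::] => // a Sa; case: S0; exists a.
have [s0 s0S s0P] := IHn S.
have /choice [s sP] : forall N, exists s : seq A, (forall b, b \in s -> S b) /\
    forall a, S a -> g a n = N ->
      exists2 b, b \in s & forall i, (i < n.+1)%N -> (g b i <= g a i)%N.
  move=> N; have [s sS sP] := IHn [set a | S a /\ g a n = N].
  exists s; split=> [b /sS[]//|a Sa gaN].
  have [b bs gb] := sP a (conj Sa gaN); exists b => // i.
  rewrite ltnS leq_eqVlt => /orP[/eqP ->|/gb //].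
  by have [_ ->] := sS b bs; rewrite gaN.
pose M := (\max_(b <- s0) g b n)%N.
exists (s0 ++ flatten [seq s N | N <- iota 0 M]) => [b|a Sa].
  rewrite mem_cat => /orP[/s0S//|/flatten_mapP[N _]].
  by have [sS _] := sP N; apply: sS.
have [Mga|gaM] := leqP M (g a n).
  have [b bs0 gb] := s0P a Sa; exists b; first by rewrite mem_cat bs0.
  move=> i; rewrite ltnS leq_eqVlt => /orP[/eqP ->|/gb //].
  by apply: leq_trans Mga; rewrite /M (big_rem b bs0) /= leq_maxl.
have [_ /(_ a Sa erefl) [b bs gb]] := sP (g a n).
exists b => //; rewrite mem_cat; apply/orP; right.
by apply/flatten_mapP; exists (g a n); rewrite ?mem_iota.
Qed.

(** [I] is the vanishing ideal of the common zeros of [F]. The leading monomial of each nonzero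
    member is divisible by that of some member of [s], so subtracting a multiple of the latter
    lowers it without leaving [I]. *)
Lemma zero_locus_finite {K : fieldType} {k : nat} (F : set (mpoly k K)) :
  exists s : seq (mpoly k K), forall v,
    (forall f, F f -> meval v f = 0) <->
    (forall f, f \in s -> meval v f = 0).
Proof.
pose I := [set p : mpoly k K | forall v,
  (forall f, F f -> meval v f = 0) -> meval v p = 0].
pose g (p : mpoly k K) i := nth 0%N (multinom_val (mlead p)) i.
have [s sI sP] := dickson k [set p | I p /\ p != 0] g.
exists s => v; split=> [Fv f /sI[If _]|sv f Ff]; first exact: If.
have If : I f by move=> w; apply.
elim/mleadrect: f If {Ff} => p IHp Ip.
have [->|p0] := eqVneq p 0; first exact: meval0.
have [b bs bp] := sP p (conj Ip p0); have [Ib b0] := sI b bs.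
pose m := mnm_sub (mlead p) (mlead b).
have mE : mnm_add m (mlead b) = mlead p.
  by apply/submK/mnm_lepP => i; rewrite !(mnm_nth 0%N); apply: bp.
pose r := (mcoeff (mlead p) p / mcoeff (mlead b) b) *: (b * mpolyX K m).
have rv w : meval w b = 0 -> meval w r = 0.
  by move=> bw; rewrite mevalZ mevalM bw mul0r mulr0.
have rp : mcoeff (mlead p) r = mcoeff (mlead p) p.
  by rewrite mcoeffZ -{2}mE mcoeffMX divfK // mleadc_eq0.
have Ipr : I (p - r) by move=> w Fw; rewrite mevalB (Ip w Fw) (rv w (Ib w Fw)) subr0.
suff : meval v (p - r) = 0 by rewrite mevalB (rv v (sv b bs)) subr0.
have [->|pr0] := eqVneq (p - r) 0; first exact: meval0.
(* If the leading monomials were equal, the leading coefficient of [p - r] would be a difference of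
   equal coefficients, hence 0. *)
apply: IHp => //; rewrite lt_neqAle; apply/andP; split.
  apply: contra_neq pr0 => prp; apply/eqP.
  by rewrite -mleadc_eq0 prp mcoeffB rp subrr.
apply: le_trans (mleadB_le _ _) _; rewrite leUx lexx /=.
apply: le_trans (mleadZ_le _ _) _; apply: le_trans (mleadM_le _ _) _.
by rewrite mleadXm addmC mE.
Qed.

(** * Definability by first-order formulas *)

(* Coordinate 0 of an environment holds t, coordinates 1..k hold x. *)
Definition definable {R : rcfType} {k : nat} (P : R -> 'rV[R]_k -> Prop) :=
  exists f : ord.formula R, forall e,
    ord.holds e f <-> P e`_0 (\row_i e`_i.+1).

(** Terms may contain inverses; [ord.to_rform] removes them before quantifiers are eliminated. *)
Definition polynomial_fun {R : rcfType} {k : nat} (F : R -> 'rV[R]_k -> R) :=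
  exists u : GRing.term R, forall e, GRing.eval e u = F e`_0 (\row_i e`_i.+1).

Section Definable.
Context {R : rcfType} {k : nat}.
Implicit Types (P Q : R -> 'rV[R]_k -> Prop) (F G : R -> 'rV[R]_k -> R).

Lemma definable_ext P Q : (forall t x, P t x <-> Q t x) -> definable P -> definable Q.
Proof. by move=> PQ [f fP]; exists f => e; rewrite fP. Qed.

Lemma definable_and P Q :
  definable P -> definable Q -> definable (fun t x => P t x /\ Q t x).
Proof.
move=> [f fP] [g gQ]; exists (ord.And f g) => e /=.
by rewrite fP gQ.
Qed.

Lemma definable_or P Q :
  definable P -> definable Q -> definable (fun t x => P t x \/ Q t x).
Proof.
move=> [f fP] [g gQ]; exists (ord.Or f g) => e /=.
by rewrite fP gQ.
Qed.

Lemma definable_forall_mem (I : eqType) (s : seq I) (P : I -> R -> 'rV[R]_k -> Prop) :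
  (forall i, definable (P i)) -> definable (fun t x => forall i, i \in s -> P i t x).
Proof.
move=> dP; elim: s => [|i s IHs].
  by exists (ord.Bool true).
apply: definable_ext (definable_and _ _ (dP i) IHs) => t x; split.
  by move=> [Pi Ps] j; rewrite inE => /orP[/eqP ->|/Ps].
by move=> Ps; split=> [|j js]; apply: Ps; rewrite inE ?eqxx ?js ?orbT.
Qed.

Lemma definable_exists_mem (I : eqType) (s : seq I) (P : I -> R -> 'rV[R]_k -> Prop) :
  (forall i, definable (P i)) -> definable (fun t x => exists2 i, i \in s & P i t x).
Proof.
move=> dP; elim: s => [|i s IHs].
  by exists (ord.Bool false) => e; split=> // -[].
apply: definable_ext (definable_or _ _ (dP i) IHs) => t x; split.
  by move=> [Pi|[j js Pj]]; [exists i|exists j]; rewrite ?inE ?eqxx ?js ?orbT.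
move=> [j]; rewrite inE => /orP[/eqP -> Pi|js Pj]; first by left.
by right; exists j.
Qed.

Lemma definable_eq F G :
  polynomial_fun F -> polynomial_fun G -> definable (fun t x => F t x = G t x).
Proof.
move=> [u uF] [v vG]; exists (ord.Equal u v) => e /=.
by rewrite uF vG.
Qed.

Lemma definable_lt F G :
  polynomial_fun F -> polynomial_fun G -> definable (fun t x => F t x < G t x).
Proof.
move=> [u uF] [v vG]; exists (ord.Lt u v) => e /=.
by rewrite uF vG.
Qed.

Lemma polynomial_fun_cst (c : R) : polynomial_fun (fun (_ : R) (_ : 'rV[R]_k) => c).
Proof. by exists (GRing.Const c). Qed.

Lemma polynomial_fun_param : polynomial_fun (fun (t : R) (_ : 'rV[R]_k) => t).
Proof. by exists (GRing.Var _ 0). Qed.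

Lemma polynomial_fun_coord (i : 'I_k) :
  polynomial_fun (fun (_ : R) (x : 'rV[R]_k) => x ord0 i).
Proof. by exists (GRing.Var _ i.+1) => e; rewrite mxE. Qed.

Lemma polynomial_funD F G : polynomial_fun F -> polynomial_fun G ->
  polynomial_fun (fun t x => F t x + G t x).
Proof. by move=> [u uF] [v vG]; exists (GRing.Add u v) => e /=; rewrite uF vG. Qed.

Lemma polynomial_funN F : polynomial_fun F -> polynomial_fun (fun t x => - F t x).
Proof. by move=> [u uF]; exists (GRing.Opp u) => e /=; rewrite uF. Qed.

Lemma polynomial_funM F G : polynomial_fun F -> polynomial_fun G ->
  polynomial_fun (fun t x => F t x * G t x).
Proof. by move=> [u uF] [v vG]; exists (GRing.Mul u v) => e /=; rewrite uF vG. Qed.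

Lemma polynomial_funX n F :
  polynomial_fun F -> polynomial_fun (fun t x => F t x ^+ n).
Proof. by move=> [u uF]; exists (GRing.Exp u n) => e /=; rewrite uF. Qed.

Lemma polynomial_fun_sum (I : Type) (s : seq I) (F : I -> R -> 'rV[R]_k -> R) :
  (forall i, polynomial_fun (F i)) -> polynomial_fun (fun t x => \sum_(i <- s) F i t x).
Proof.
move=> dF; elim: s => [|i s [v vF]].
  by exists (GRing.Const 0) => e; rewrite big_nil.
have [u uF] := dF i; exists (GRing.Add u v) => e /=.
by rewrite big_cons uF vF.
Qed.

Lemma polynomial_fun_prod (I : Type) (s : seq I) (F : I -> R -> 'rV[R]_k -> R) :
  (forall i, polynomial_fun (F i)) -> polynomial_fun (fun t x => \prod_(i <- s) F i t x).
Proof.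
move=> dF; elim: s => [|i s [v vF]].
  by exists (GRing.Const 1) => e; rewrite big_nil.
have [u uF] := dF i; exists (GRing.Mul u v) => e /=.
by rewrite big_cons uF vF.
Qed.

Lemma polynomial_fun_meval (f : mpoly k R) :
  polynomial_fun (fun (_ : R) (x : 'rV[R]_k) => meval (fun i => x ord0 i) f).
Proof.
have : polynomial_fun (fun (_ : R) (x : 'rV[R]_k) =>
    \sum_(m <- msupp f) mcoeff m f * \prod_(i <- index_enum 'I_k) x ord0 i ^+ m i).
  apply: polynomial_fun_sum => m; apply: polynomial_funM (polynomial_fun_cst _) _.
  by apply: polynomial_fun_prod => i; apply: polynomial_funX (polynomial_fun_coord i).
by case=> u uF; exists u => e; rewrite uF mevalE.
Qed.

End Definable.

(** * Projection and eventual behaviour at 0+ *)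

Lemma holds_foldr_Exists {R : rcfType} (s : seq nat) (f : ord.formula R) e :
  ord.holds e (foldr ord.Exists f s) <->
  exists e', (forall j, j \notin s -> e'`_j = e`_j) /\ ord.holds e' f.
Proof.
elim: s e => [|i s IHs] e /=.
  (* Environments with the same entries may differ in length, so [ord.eq_holds] has to transport the
     truth of [f]. *)
  split=> [fe|[e' [ee' /ord.eq_holds]]]; first by exists e.
  by apply=> j; rewrite ee'.
split=> [[x /IHs[e' [ee' fe']]]|[e' [ee' fe']]].
  exists e'; split=> // j; rewrite inE negb_or => /andP[ji js].
  by rewrite ee' // nth_set_nth /= (negPf ji).
exists e'`_i; apply/IHs; exists e'; split=> // j js.
rewrite nth_set_nth /=; case: eqP => [-> //|/eqP ji].
by rewrite ee' // inE negb_or ji.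
Qed.

Lemma definable_projection {R : rcfType} {k : nat} (P : R -> 'rV[R]_k -> Prop) :
  definable P -> exists g : ord.formula R, forall t,
    ord.holds [:: t] g <-> exists x, P t x.
Proof.
move=> [f fP]; exists (foldr ord.Exists f (iota 1 k)) => t.
rewrite holds_foldr_Exists; split=> [[e [et /fP Pe]]|[x Ptx]].
  by exists (\row_i e`_i.+1); rewrite -[t]/([:: t]`_0) -et ?mem_iota.
exists (t :: [seq x ord0 i | i <- enum 'I_k]); split.
  (* Past position [k] both environments return the default 0. *)
  move=> [//|j]; rewrite mem_iota /= add1n ltnS -leqNgt => kj.
  by rewrite !nth_default // size_map size_enum_ord.
apply/fP => /=; congr (P _ _): Ptx; apply/rowP => i; rewrite mxE.
by rewrite (nth_map i) ?size_enum_ord// nth_ord_enum.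
Qed.

Lemma term_polynomial {R : rcfType} (u : GRing.term R) : GRing.rterm u ->
  exists p : {poly R}, forall t, GRing.eval [:: t] u = p.[t].
Proof.
elim: u => //=.
(* Only variable 0 is set in [[:: t]]; every other one reads the default 0. *)
- move=> [|n] _; [exists 'X|exists 0] => t; first by rewrite hornerX.
  by rewrite horner0 nth_default.
- by move=> c _; exists c%:P => t; rewrite hornerC.
- by move=> n _; exists n%:R%:P => t; rewrite hornerC.
- move=> u IHu v IHv /andP[/IHu[p pu] /IHv[q qv]].
  by exists (p + q) => t; rewrite hornerD pu qv.
- by move=> u IHu /IHu[p pu]; exists (- p) => t; rewrite hornerN pu.
- by move=> u IHu n /IHu[p pu]; exists (p *+ n) => t; rewrite hornerMn pu.
- move=> u IHu v IHv /andP[/IHu[p pu] /IHv[q qv]].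
  by exists (p * q) => t; rewrite hornerM pu qv.
- by move=> u IHu n /IHu[p pu]; exists (p ^+ n) => t; rewrite horner_exp pu.
Qed.

Lemma poly_sgr_right {R : realType} (p : {poly R}) :
  exists s, \forall t \near (0 : R)^'+, Num.sg p.[t] = s.
Proof.
have [->|p0] := eqVneq p 0; first by exists 0; near=> t; rewrite horner0 sgr0.
exists (polyrcf.sgp_right p 0).
(* [polyrcf.neighpr p 0 1] is the interval from 0 to the next root of [p], cut off at 1; the sign of
   [p] is constant there. *)
have [d] := polyrcf.neighpr_wit ltr01 p0.
rewrite /polyrcf.neighpr inE/= => /andP[d0 dr]; near=> t.
apply: (@polyrcf.sgr_neighpr _ 1); rewrite /polyrcf.neighpr inE/=.
apply/andP; split; first by near: t; exact: nbhs_right_gt.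
by apply: lt_trans dr; near: t; exact: nbhs_right_lt.
Unshelve. all: by end_near. Qed.

(** Each comparison is decided by the sign of a polynomial in [t], which is constant near 0+;
    connectives combine finitely many such conditions. *)
Lemma qf_eval_right {R : realType} (g : ord.formula R) :
  ord.qf_form g -> ord.rformula g ->
  exists b, \forall t \near (0 : R)^'+, ord.qf_eval [:: t] g = b.
Proof.
have cmp (u v : GRing.term R) : GRing.rterm u && GRing.rterm v -> exists s,
    \forall t \near (0 : R)^'+, Num.sg (GRing.eval [:: t] v - GRing.eval [:: t] u) = s.
  move=> /andP[/term_polynomial[p pu] /term_polynomial[q qv]].
  have [s sP] := poly_sgr_right (q - p); exists s.
  by apply: filterS sP => t; rewrite pu qv hornerD hornerN.
elim: g => //=.
- by move=> b _ _; exists b; near=> t.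
- move=> u v _ /cmp[s sP]; exists (s == 0); apply: filterS sP => t <-.
  by rewrite sgr_eq0 subr_eq0 eq_sym.
- move=> u v _ /cmp[s sP]; exists (0 < s); apply: filterS sP => t <-.
  by rewrite sgr_gt0 subr_gt0.
- move=> u v _ /cmp[s sP]; exists (0 <= s); apply: filterS sP => t <-.
  by rewrite sgr_ge0 subr_ge0.
- move=> f IHf g IHg /andP[/IHf{}IHf /IHg{}IHg] /andP[/IHf[a aP] /IHg[b bP]].
  by exists (a && b); apply: filterS2 aP bP => t -> ->.
- move=> f IHf g IHg /andP[/IHf{}IHf /IHg{}IHg] /andP[/IHf[a aP] /IHg[b bP]].
  by exists (a || b); apply: filterS2 aP bP => t -> ->.
- move=> f IHf g IHg /andP[/IHf{}IHf /IHg{}IHg] /andP[/IHf[a aP] /IHg[b bP]].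
  by exists (a ==> b); apply: filterS2 aP bP => t -> ->.
- move=> f IHf /IHf{}IHf /IHf[a aP].
  by exists (~~ a); apply: filterS aP => t ->.
Unshelve. all: by end_near. Qed.

(* One-variable o-minimality at 0+, through quantifier elimination. *)
Lemma definable_projection_right {R : realType} {k : nat}
    (P : R -> 'rV[R]_k -> Prop) : definable P ->
  (\forall t \near (0 : R)^'+, exists x, P t x) \/
  (\forall t \near (0 : R)^'+, ~ exists x, P t x).
Proof.
move=> /definable_projection[g gP].
(* [h] is the quantifier-free formula evaluated by the decision procedure behind
   [qe_rcf.rcf_satP]. *)
pose h := ord.quantifier_elim
  (fun i bc => qe_rcf.qfr_to_formula (qe_rcf.wproj i bc)) (ord.to_rform g).
have hP t : reflect (exists x, P t x) (ord.qf_eval [:: t] h).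
  by apply: (iffP (qe_rcf.rcf_satP [:: t] g)) => /gP.
have /andP[qh rh] := ord.quantifier_elim_wf
  (@qe_rcf.wf_QE_wproj R) (ord.to_rform_rformula g).
have [[] hb] := qf_eval_right h qh rh; [left|right]; apply: filterS hb => t.
  by move/hP.
by move=> hF /hP; rewrite hF.
Qed.

(** * Semi-algebraic sets near a ray *)

(** A formula holds only finitely many equations, so [F] is replaced by a finite family with the
    same zeros. *)
Lemma basic_semialgebraic_definable {R : realType} {k : nat} (B : set 'rV[R]_k) :
  basic_semialgebraic B -> definable (fun (_ : R) x => B x).
Proof.
move=> [F [H [/finite_seqP[h ->] ->]]]; have [s sF] := zero_locus_finite F.
have d0 := definable_forall_mem _ s _ (fun f => definable_eq _ _
  (polynomial_fun_meval f) (polynomial_fun_cst (0 : R))).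
have dh := definable_forall_mem _ h _ (fun f => definable_lt _ _
  (polynomial_fun_cst (0 : R)) (polynomial_fun_meval f)).
by apply: definable_ext (definable_and _ _ d0 dh) => t x /=; rewrite -sF.
Qed.

Lemma semialgebraic_definable {R : realType} {k : nat} (Theta : set 'rV[R]_k) :
  semialgebraic Theta -> definable (fun (_ : R) x => Theta x).
Proof.
move=> [m [B [bB ->]]].
have dB i := basic_semialgebraic_definable _ (bB i).
apply: definable_ext (definable_exists_mem _ (enum 'I_m) _ dB) => t x /=.
by split=> [[i _ Bi]|[i _ Bi]]; exists i => //; rewrite mem_enum.
Qed.

(** The infimum of [g] on [S] need not be attained, hence the slack [eta]. *)
Lemma near_minimizer {R : realType} {T : Type} (S : set T) (g : T -> R) (eta : R) :
  S !=set0 -> (forall x, 0 <= g x) -> 0 < eta ->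
  exists2 x, S x & forall y, S y -> g x <= g y + eta.
Proof.
move=> [x0 Sx0] g0 eta0.
have lbS : has_lbound [set g x | x in S] by exists 0 => _ [x _ <-].
have [|_ [x Sx <-] gx] := inf_adherent eta0 (E := [set g x | x in S]).
  by split=> //; exists (g x0), x0.
exists x => // y Sy; apply: le_trans (ltW gx) _; rewrite lerD2r.
by apply: ge_inf => //; exists y.
Qed.

(** The norm is the sup norm, so a ball is cut out by linear inequalities, which formulas can
    express. *)
Lemma row_norm_lt {R : realType} {k : nat} (v : 'rV[R]_k) (e : R) : 0 < e ->
  `|v| < e <-> forall i, - e < v ord0 i < e.
Proof.
move=> e0; rewrite /Num.norm/= mx_normrE; split=> [/bigmax_ltP[_ ve] i|ve].
  by rewrite -ltr_norml; have := ve (ord0, i); apply.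
by apply/bigmax_ltP; split=> // -[i j] _; rewrite ord1 ltr_norml.
Qed.

Lemma semialgebraic_near_ray {R : realType} {k : nat} (Theta : set 'rV[R]_k)
    (theta tau : 'rV[R]_k) (e : R) : semialgebraic Theta -> 0 < e ->
  (\forall t \near (0 : R)^'+, exists2 x, Theta x & `|x - theta - t *: tau| < e * t) \/
  (\forall t \near (0 : R)^'+, ~ exists2 x, Theta x & `|x - theta - t *: tau| < e * t).
Proof.
move=> sT e0.
pose P t (x : 'rV[R]_k) := Theta x /\ forall i, i \in enum 'I_k ->
  - (e * t) < x ord0 i + (- theta ord0 i + - (t * tau ord0 i)) /\
  x ord0 i + (- theta ord0 i + - (t * tau ord0 i)) < e * t.
have dP : definable P.
  apply: definable_and; first exact: semialgebraic_definable.
  apply: definable_forall_mem => i.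
  have det : polynomial_fun (fun (t : R) (_ : 'rV[R]_k) => e * t).
    exact: polynomial_funM (polynomial_fun_cst _) polynomial_fun_param.
  have dx : polynomial_fun (fun (t : R) (x : 'rV[R]_k) =>
      x ord0 i + (- theta ord0 i + - (t * tau ord0 i))).
    apply: polynomial_funD (polynomial_fun_coord i) _.
    apply: polynomial_funD (polynomial_fun_cst _) _.
    apply: polynomial_funN.
    exact: polynomial_funM polynomial_fun_param (polynomial_fun_cst _).
  by apply: definable_and; apply: definable_lt => //; apply: polynomial_funN.
(* Positivity of [t] makes the radius [e * t] positive, as [row_norm_lt] requires. *)
have PE t : 0 < t ->
    (exists x, P t x) <-> exists2 x, Theta x & `|x - theta - t *: tau| < e * t.
  move=> t0; have et0 : 0 < e * t by rewrite mulr_gt0.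
  split=> [[x [Tx xP]]|[x Tx /(row_norm_lt _ _ et0) xP]].
    exists x => //; apply/row_norm_lt => // i; rewrite !mxE -addrA; apply/andP.
    by apply: xP; rewrite mem_enum.
  by exists x; split=> // i _; have := xP i; rewrite !mxE -addrA => /andP.
have [H|H] := definable_projection_right _ dP; [left|right]; near=> t.
  by apply/PE; [near: t; exact: nbhs_right_gt | near: t].
by move/PE => /(_ ltac:(near: t; exact: nbhs_right_gt)); near: t.
Unshelve. all: by end_near. Qed.

(** * Construction of the curve *)

Theorem lemma3p3 (R : realType) (k : nat) (Theta : set 'rV[R]_k)
    (hTheta : semialgebraic Theta) (theta : 'rV[R]_k)
    (htheta : Theta theta) :
  Chernoff_regular Theta theta.
Proof.
move=> tau [a [u [a0 Tu ucv aucv]]].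
have [->|tau0] := eqVneq tau 0.
  exists 1, (fun=> theta); split=> //.
  by rewrite subrr; under eq_fun do rewrite scaler0; exact: cvg_cst.
have ainv : (a n)^-1 @[n --> \oo] --> (0 : R).
  (* This quotient tends to 0 / |tau|, and it equals 1 / a_n as soon as its denominator is
     nonzero. *)
  have q0 : `|u n - theta| / `|a n *: (u n - theta)| @[n --> \oo] --> (0 : R).
    have -> : 0 = `|theta - theta| / `|tau| by rewrite subrr normr0 mul0r.
    apply: cvgM; first by apply: cvg_norm; apply: cvgB => //; exact: cvg_cst.
    by apply: cvgV; [rewrite normr_eq0|exact: cvg_norm].
  apply: cvg_trans q0; apply: near_eq_cvg.
  have /(cvgr_norm_gt _ aucv) : 0 < `|tau| by rewrite normr_gt0.
  apply: filterS => n; rewrite normrZ (gtr0_norm (a0 n)) => aun.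
  have un0 : `|u n - theta| != 0.
    by apply: contraTneq aun => ->; rewrite mulr0 ltxx.
  by rewrite invfM mulrCA divff// mulr1.
have dist e : 0 < e ->
    \forall t \near (0 : R)^'+, exists2 x, Theta x & `|x - theta - t *: tau| < e * t.
  move=> e0; have [//|far] := semialgebraic_near_ray Theta theta tau e hTheta e0.
  (* The filter at 0+ is that of neighbourhoods of 0 restricted to positive reals; pulled back along
     1 / a_n, the restriction becomes a premise. *)
  have {}far : \forall n \near \oo, 0 < (a n)^-1 ->
      ~ exists2 x, Theta x & `|x - theta - (a n)^-1 *: tau| < e * (a n)^-1 := ainv _ far.
  move/cvgrPdist_lt : aucv => /(_ _ e0) aue.
  have [n [/= farn aun]] := filter_ex (filterI far aue).
  have := farn; rewrite invr_gt0 a0 => /(_ isT) [].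
  (* After multiplication by a_n the required bound is |a_n (u_n - theta) - tau| < e. *)
  exists (u n) => //; rewrite ltr_pdivlMr// mulrC -{1}(gtr0_norm (a0 n)) -normrZ.
  by rewrite scalerBr scalerA divff ?gt_eqF// scale1r distrC.
have /choice [alpha alphaP] : forall t : R, exists x, Theta x /\ (0 < t ->
    forall y, Theta y -> `|x - theta - t *: tau| <= `|y - theta - t *: tau| + t ^+ 2).
  move=> t; have [t0|t0] := ltP 0 t; last by exists theta.
  have [x Tx xP] := @near_minimizer R _ Theta (fun x => `|x - theta - t *: tau|)
    (t ^+ 2) (ex_intro _ theta htheta) (fun=> normr_ge0 _) (exprn_gt0 2 t0).
  by exists x.
(* The choice of [alpha] at 0 is an arbitrary point of [Theta], so the value there is reset to
   [theta]. *)
exists 1, (fun t => if t == 0 then theta else alpha t); split=> //.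
- by move=> t _; case: eqP => // _; have [] := alphaP t.
- by rewrite eqxx.
apply/cvgrPdist_le => e e0; rewrite eqxx.
(* Half of [e] bounds the distance from the ray to [Theta], the other half absorbs the slack, as t^2
   <= (e / 2) t for small t. *)
have e20 : 0 < e / 2 by rewrite divr_gt0.
have := dist _ e20; apply: filter_app; near=> t => -[y Ty yt].
have t0 : 0 < t by near: t; exact: nbhs_right_gt.
rewrite gt_eqF//; have [_ /(_ t0 y Ty) alphat] := alphaP t.
rewrite -(ler_pM2l t0) -{1}(gtr0_norm t0) -normrZ scalerBr scalerA divff ?gt_eqF//.
rewrite scale1r distrC (le_trans alphat)//.
have te : t <= e / 2 by near: t; exact: nbhs_right_le.
have : t * t <= e / 2 * t by rewrite ler_pM2r.
by rewrite expr2 => tt; lra.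
Unshelve. all: by end_near. Qed.
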